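(* Let $G$ be a betweenness-uniform graph with betweenness $\alpha\le 9/10$. Then $\alpha=\frac{\ell}{\ell+1}$ for some integer $\ell\ge 0$, and the complement of $G$ is a graph whose every connected component is isomorphic to the star $K_{1,\ell}$.
   Context: All graphs are finite, simple, undirected, with nonempty vertex set. The complement $\overline{G}$ of $G$ has vertex set $V(G)$ and edge set $\binom{V(G)}{2}\setminus E(G)$. For distinct vertices $v,w$ of a connected graph $G$, let $\sigma_{vw}$ be the number of shortest paths between $v$ and $w$, and let $\sigma_{vw}(x)$ be the number of those containing $x$ as an internal vertex (so $\sigma_{vw}(x)=0$ if $x\in\{v,w\}$). The betweenness of a vertex $x$ is $B_G(x)=\sum_{\{v,w\}\subseteq V(G)}\frac{\sigma_{vw}(x)}{\sigma_{vw}}$, the sum being over unordered pairs of distinct vertices. A betweenness-uniform graph (BUG) is a connected graph $G$ in which $B_G(x)=B_G(y)$ for all $x,y\in V(G)$; its betweenness is this common value. $K_{1,\ell}$ is the star with $\ell$ leaves; $K_{1,0}$ is the single-vertex graph. *)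

(* Defs.v *)
From mathcomp Require Import all_boot all_order all_algebra.
Set Implicit Arguments.
Unset Strict Implicit.
Unset Printing Implicit Defensive.
Import GRing.Theory.
Local Open Scope ring_scope.

(* The vertex type may be empty; nonemptiness is a separate hypothesis. *)
Record graph := Graph {
  vertex :> finType;
  edge : rel vertex;
  edge_sym : symmetric edge;
  edge_irr : irreflexive edge
}.
Arguments edge {g} : rename.

Section Compl.
Variable G : graph.

Definition compl_edge : rel G := fun x y => (x != y) && ~~ edge x y.

Lemma compl_edge_sym : symmetric compl_edge.
Proof. by move=> x y; rewrite /compl_edge eq_sym edge_sym. Qed.

Lemma compl_edge_irr : irreflexive compl_edge.
Proof. by move=> x; rewrite /compl_edge eqxx. Qed.

Definition compl : graph := Graph compl_edge_sym compl_edge_irr.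

End Compl.

Section Induced.
Variables (G : graph) (A : {set G}).

Definition induced_edge : rel {x : G | x \in A} :=
  fun x y => edge (val x) (val y).

Lemma induced_edge_sym : symmetric induced_edge.
Proof. by move=> x y; apply: edge_sym. Qed.

Lemma induced_edge_irr : irreflexive induced_edge.
Proof. by move=> x; apply: edge_irr. Qed.

Definition induced : graph := Graph induced_edge_sym induced_edge_irr.

End Induced.

Section Star.
Variable l : nat.

(* The centre is [ord0]; the other [l] elements are the leaves. *)
Definition star_edge : rel 'I_l.+1 :=
  fun i j => (i == ord0) (+) (j == ord0).

Lemma star_edge_sym : symmetric star_edge.
Proof. by move=> i j; apply: addbC. Qed.

Lemma star_edge_irr : irreflexive star_edge.
Proof. by move=> i; apply: addbb. Qed.

Definition star : graph := Graph star_edge_sym star_edge_irr.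

End Star.

Definition isomorphic (G H : graph) : Prop :=
  exists2 f : G -> H, bijective f & forall x y, edge (f x) (f y) = edge x y.

Definition connected (G : graph) : Prop :=
  forall x y : G, connect edge x y.

Definition components (G : graph) : {set {set G}} :=
  [set [set y | connect edge x y] | x in G].

Section Betweenness.
Variable G : graph.
Implicit Types v w x : G.

(* Paths with [k] edges from [v] to [w]; the tuple lists the vertices after
   [v]. *)
Definition paths v w k : {set k.-tuple G} :=
  [set p : k.-tuple G |
    [&& path edge v p, last v p == w & uniq (v :: p)]].

(* Equal to [#|G|] when [v] and [w] are not connected. *)
Definition dist v w : nat :=
  find (fun k => paths v w k != set0) (iota 0 #|G|).

Definition shortest_paths v w : {set (dist v w).-tuple G} :=
  paths v w (dist v w).

Definition sigma v w : nat := #|shortest_paths v w|.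

Definition sigma_through v w x : nat :=
  #|[set p : (dist v w).-tuple G in shortest_paths v w |
      [&& x \in v :: p, x != v & x != w]]|.

(* The enumeration order of [G] selects one orientation of each unordered pair
   of distinct vertices; the summand is symmetric in [v] and [w]. *)
Definition betweenness x : rat :=
  \sum_(v : G) \sum_(w : G | (enum_rank v < enum_rank w)%N)
     (sigma_through v w x)%:R / (sigma v w)%:R.

End Betweenness.

Definition betweenness_uniform (G : graph) : Prop :=
  connected G /\ forall x y : G, betweenness x = betweenness y.

(* Main.v *)
Require Import Defs.
From mathcomp Require Import all_boot all_order all_algebra.
From mathcomp Require Import ring lra zify.
Set Implicit Arguments.
Unset Strict Implicit.
Unset Printing Implicit Defensive.
Import Order.TTheory GRing.Theory Num.Theory.

(* Summing betweenness over all vertices gives the sum of [d(v,w) - 1] over all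
   pairs; if [d(u,v) >= 3] then every vertex misses [u] or [v], which makes this
   sum at least [n]. As [alpha < 1], the diameter is at most 2, and everything
   can be read off the complement [H], with neighbourhoods [N]: [H] has
   [alpha n] edges, and an edge [uw] of [H] contributes
   [1 / (n - |N(u) :|: N(w)|)] to the vertices outside [N(u) :|: N(w)]. Hence
   the total weight [W] of the edges touching [x], i.e. with
   [x \in N(u) :|: N(w)], does not depend on [x].

   The edges touching a leaf of [H] also touch its neighbour; as the weights are
   positive, no further edge touches the neighbour, so every component of [H]
   with a leaf is a star. The average degree [2 alpha] is below 2, so there is
   a leaf unless [H] has no edge, and [W = l / (n - l - 1)] forces all stars to
   have the same number [l] of leaves.

   In the other components all degrees are at least 2, so an edge at [v] reaches
   at most as many vertices as there are edges touching [v]. If at most [l] edges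
   touched each vertex, the weights would be too small to sum to [W]; so at least
   [l + 1] edges, each of weight at least [1 / (n - 3)], touch some vertex, and
   [n <= l^2 - l + 1]. This contradicts the bound [9 n / 10] on the number of
   edges, counting separately the edges in stars and the others. *)

(* [p] and [k] count the vertices inside and outside the star components, and
   [dp], [dq] are the corresponding degree sums. *)
Lemma star_count_contradiction (l p k dp dq : nat) : 0 < l -> 0 < k -> l.+1 <= p ->
  l.+1 * dp = 2 * l * p -> 10 * (dp + dq) <= 18 * (p + k) ->
  p + k + l <= l * l + 1 -> 2 * l.+1 <= dq -> 2 * k <= dq ->
  (dq = 2 * k -> l <= 3) -> False.
Proof.
move=> l0 k0 lp dpE le_d le_n dq_l dq_k dq_eq.
(* For [l >= 9] the stars have average degree [2l/(l+1) >= 18/10] and the other vertices at least 2,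
   which exceeds the total allowed since [k > 0]. *)
have l8 : l <= 8.
  rewrite leqNgt; apply/negP=> l9.
  have : l.+1 * (10 * (dp + dq)) <= l.+1 * (18 * (p + k)) by rewrite leq_mul2l le_d orbT.
  have : 9 * p <= l * p by rewrite leq_mul2r l9 orbT.
  have : l.+1 * (2 * k) <= l.+1 * dq by rewrite leq_mul2l dq_k orbT.
  have : 0 < l * k by rewrite muln_gt0 l0.
  lia.
have {}dq_eq : (2 * k < dq) || (l <= 3).
  by rewrite ltn_neqAle dq_k andbT; case: eqP => //= E; apply: dq_eq.
clear dq_k.
(* For each fixed [l] from 0 to 8 the constraints become linear. *)
do 9 (destruct l as [|l]; [lia|]); lia.
Qed.

Local Open Scope ring_scope.

(** * Oriented edges: reach and touching *)

Section Darts.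
Variables (T : finType) (h : rel T).
Hypotheses (h_sym : symmetric h) (h_irr : irreflexive h).
Implicit Types (x y z u v w : T) (e : T * T) (A : {set T}).

Definition nbr x := [set y | h x y].
(** Both orientations of an edge occur, so dart counts and dart weights are twice those of edges. *)
Definition darts := [set e : T * T | h e.1 e.2].
(** When [h] is the complement of a graph, the vertices outside the reach of a dart are the common
    neighbours of its ends in that graph. *)
Definition reach e := nbr e.1 :|: nbr e.2.
Definition touching x := [set e in darts | x \in reach e].
Definition darts_at y := [set e in darts | (e.1 == y) || (e.2 == y)].
Definition darts_from A := [set e in darts | e.1 \in A].

Lemma nbr_sym x y : (x \in nbr y) = (y \in nbr x).
Proof. by rewrite !inE h_sym. Qed.

Lemma nbrxx x : x \notin nbr x.
Proof. by rewrite inE h_irr. Qed.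

Lemma mem_reach e x : (x \in reach e) = h e.1 x || h e.2 x.
Proof. by rewrite !inE. Qed.

Lemma touchingE x : touching x = \bigcup_(y in nbr x) darts_at y.
Proof.
apply/setP=> e; apply/idP/bigcupP.
  rewrite !inE => /andP[he /orP[] hx].
    by exists e.1; rewrite !inE ?eqxx ?he // h_sym.
  by exists e.2; rewrite !inE ?eqxx ?he ?orbT // h_sym.
move=> [y]; rewrite !inE => hy /andP[-> /orP[] /eqP ->] /=.
  by rewrite h_sym hy.
by rewrite [h y x]h_sym hy orbT.
Qed.

Lemma card_darts_from A : #|darts_from A| = (\sum_(x in A) #|nbr x|)%N.
Proof.
rewrite -sum1_card.
under [RHS]eq_bigr do rewrite -sum1_card.
rewrite pair_big_dep /=; apply: eq_bigl => -[x y] /=.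
by rewrite !inE andbC.
Qed.

Lemma swap_inj : injective (fun e => (e.2, e.1)).
Proof. by move=> [a b] [c d] [-> ->]. Qed.

Lemma card_darts_at y : #|darts_at y| = (2 * #|nbr y|)%N.
Proof.
have -> : darts_at y = [set (y, z) | z in nbr y] :|: [set (z, y) | z in nbr y].
  apply/setP=> -[a b]; rewrite !inE /=; apply/andP/orP.
    move=> [hab /orP[] /eqP E].
      by left; apply/imsetP; exists b; rewrite ?inE -E.
    by right; apply/imsetP; exists a; rewrite ?inE -E // h_sym.
  by move=> [] /imsetP[z]; rewrite inE => hz [-> ->]; rewrite eqxx ?orbT ?hz // h_sym hz.
rewrite cardsU !card_imset; try by move=> ? ? [].
rewrite (_ : _ :&: _ = set0) ?cards0; first by lia.
apply/setP=> -[a b]; rewrite !inE; apply/negP=> /andP[/imsetP[z]].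
rewrite inE => hz [-> ->] /imsetP[w]; rewrite inE => hw [E _].
by move: hw; rewrite E h_irr.
Qed.

(** Reversal pairs up these darts without fixed points. Parity later raises a count above [2 * l] to
    at least [2 * l.+1]. *)
Lemma even_touching x : exists m, #|touching x| = (2 * m)%N.
Proof.
pose B := [set e in touching x | (enum_rank e.1 < enum_rank e.2)%N].
exists #|B|.
have -> : touching x = B :|: [set (e.2, e.1) | e in B].
  apply/setP=> e; rewrite in_setU; apply/idP/orP.
    case: (ltngtP (enum_rank e.1) (enum_rank e.2)) => [lt|lt|E] he.
    - by left; rewrite inE he.
    - right; apply/imsetP; exists (e.2, e.1); last by case: (e).
      by move: he; rewrite !inE /= h_sym lt andbT orbC.
    - have {}E : e.1 = e.2 by apply: enum_rank_inj; apply: val_inj.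
      by move: he; rewrite !inE E h_irr.
  case=> [|/imsetP[e']]; first by rewrite inE => /andP[].
  by rewrite inE => /andP[he' _] ->; move: he'; rewrite !inE /= h_sym orbC.
rewrite cardsU (card_imset _ swap_inj).
rewrite (_ : _ :&: _ = set0) ?cards0; first by lia.
apply/setP=> e; rewrite !inE; apply/negP=> /andP[/andP[_ lt]] /imsetP[e'].
rewrite inE => /andP[_ lt'] E; by move: lt; rewrite E /= ltnNge ltnW.
Qed.

(* The edges at [w], the edges at [v] other than [vw], and one further edge
   given by the degree hypothesis. *)
Lemma reach_touching v w : h v w -> (1 < #|nbr v|)%N ->
    (forall u, h v u -> (1 < #|nbr u|)%N) ->
  (2 * #|reach (v, w)| <= #|touching v|)%N.
Proof.
move=> hvw dv dn.
have nvw : v != w by apply: contraTneq hvw => ->; rewrite h_irr.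
have other x y : (1 < #|nbr x|)%N -> exists2 z, h x z & z != y.
  rewrite (cardsD1 y) => c.
  have /card_gt0P[z] : (0 < #|nbr x :\ y|)%N by case: (_ \in _) c; lia.
  by rewrite !inE => /andP[? ?]; exists z.
have [g [g1 g2 gv gN gt]] : exists g : T * T,
    [/\ g.1 != w, g.2 != w, g.2 != v, g.1 = v -> h w g.2 & g \in touching v].
  (* A common neighbour [u] of [v] and [w] will be assigned [(w, u)], which leaves [(v, u)] spare.
     Without one, the degrees give a walk [v], [y], [z] whose edge [yz] avoids both [v] and [w]. *)
  case: (pickP [pred u | h v u && h w u]) => [u /andP[vu wu]|none].
    exists (v, u); split=> //=.
    - by apply: contraTneq wu => ->; rewrite h_irr.
    - by apply: contraTneq vu => ->; rewrite h_irr.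
    - by rewrite !inE /= vu h_sym vu orbT.
  have [y vy yw] := other v w dv.
  have [z yz zv] := other y v (dn y vy).
  exists (y, z); split=> //=.
  - by apply/eqP=> E; move: (none y); rewrite /= vy h_sym -E yz.
  - by move=> E; move: vy; rewrite E h_irr.
  - by rewrite !inE /= yz h_sym vy.
have hg : h g.1 g.2 by move: gt; rewrite !inE => /andP[].
(* The edge [vw] is already used for [u = v], as [(w, v)]; hence [w] itself receives the spare dart
   [g]. *)
pose f u := if h w u then (w, u) else if u == w then g else (v, u).
have f_touch u : u \in reach (v, w) -> f u \in touching v.
  rewrite mem_reach /= /f; case: ifP => [wu _|wu]; first by rewrite !inE /= wu h_sym hvw.
  case: eqP => // _; rewrite orbF => vu.
  by rewrite !inE /= vu [h u v]h_sym vu orbT.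
have fP u : u \in reach (v, w) -> [\/ h w u /\ f u = (w, u), u = w /\ f u = g
    | [/\ h v u && (u != w), ~~ h w u & f u = (v, u)]].
  rewrite mem_reach /= /f; case: ifP => [wu _|wu]; first by constructor 1.
  by case: (eqVneq u w) => [|uw]; [constructor 2 | rewrite orbF andbT; constructor 3].
have f_inj : {in reach (v, w) &, injective f}.
  move=> a b ha hb; have [[wa ->]|[-> ->]|[/andP[va aw] wa ->]] := fP a ha;
    have [[wb ->]|[-> ->]|[/andP[vb bw] wb ->]] := fP b hb;
    try (by move=> [-> //]); try done.
  - by move=> E; rewrite -E eqxx in g1.
  - by move=> [E _]; rewrite E eqxx in nvw.
  - by move=> E; rewrite E eqxx in g1.
  - by move=> E; rewrite E /= in gN; rewrite gN in wb.
  - by move=> [E _]; rewrite E eqxx in nvw.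
  - by move=> E; rewrite -E /= in gN; rewrite gN in wa.
(* No value of [f] reverses another, so adding the reversed darts doubles the image. *)
have f_anti a b : a \in reach (v, w) -> b \in reach (v, w) -> f a <> ((f b).2, (f b).1).
  move=> ha hb; have [[wa ->]|[-> ->]|[/andP[va aw] wa ->]] := fP a ha;
    have [[wb ->]|[-> ->]|[/andP[vb bw] wb ->]] := fP b hb => /=.
  - by move=> [E _]; rewrite -E h_irr in wb.
  - by move=> [E _]; rewrite -E eqxx in g2.
  - by move=> [E _]; rewrite E eqxx in bw.
  - by move=> E; rewrite E eqxx in g2.
  - by move=> E; move: hg; rewrite {1}E h_irr.
  - by move=> E; rewrite E eqxx in gv.
  - by move=> [_ E]; rewrite E eqxx in aw.
  - by move=> [E _]; rewrite -E eqxx in gv.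
  - by move=> [E _]; rewrite -E h_irr in vb.
have s1 : f @: reach (v, w) \subset touching v.
  by apply/subsetP=> e /imsetP[u hu ->]; exact: f_touch.
have s2 : [set (e.2, e.1) | e in f @: reach (v, w)] \subset touching v.
  apply/subsetP=> e /imsetP[e' /(subsetP s1) he' ->].
  by move: he'; rewrite !inE /= h_sym orbC.
have /subset_leq_card : f @: reach (v, w) :|: [set (e.2, e.1) | e in f @: reach (v, w)]
    \subset touching v by rewrite subUset s1 s2.
rewrite cardsU (card_imset _ swap_inj) (card_in_imset f_inj).
rewrite (_ : _ :&: _ = set0) ?cards0; first by lia.
apply/setP=> e; rewrite !inE; apply/negP=> /andP[/imsetP[a ha ->]].
by move=> /imsetP[_ /imsetP[b hb ->]]; exact: f_anti.
Qed.
End Darts.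

(** * Constant touching weight and its consequences for leaves *)

Section Balanced.
Variables (T : finType) (h : rel T) (alpha : rat).
Hypotheses (h_sym : symmetric h) (h_irr : irreflexive h).
Implicit Types (x y z u v w : T) (e : T * T) (A : {set T}).

Local Notation nbr := (nbr h).
Local Notation darts := (darts h).
Local Notation reach := (reach h).
Local Notation touching := (touching h).

Definition wt e : rat := (#|~: reach e|)%:R^-1.

Hypothesis reach_proper : forall e, e \in darts -> (0 < #|~: reach e|)%N.
Hypothesis balanced :
  forall x, \sum_(e in darts | x \notin reach e) wt e = 2 * alpha.

Lemma wt_gt0 e : e \in darts -> 0 < wt e.
Proof. by move=> he; rewrite invr_gt0 ltr0n reach_proper. Qed.

(** Sum [balanced] over all vertices: a dart gives its weight to each vertex outside its reach, in
    total 1. *)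
Lemma card_darts : 2 * alpha * #|T|%:R = #|darts|%:R.
Proof.
have: \sum_x \sum_(e in darts | x \notin reach e) wt e = 2 * alpha * #|T|%:R.
  by rewrite (eq_bigr _ (fun x _ => balanced x)) sumr_const mulr_natr.
move=> <-; rewrite (exchange_big_dep (mem darts)) /=; last by move=> x e _ /andP[].
rewrite -sum1_card natr_sum; apply: eq_bigr => e he.
rewrite (eq_bigl (mem (~: reach e))) => [|x]; last by rewrite he /= in_setC.
by rewrite sumr_const -[LHS]mulr_natr mulVf // pnatr_eq0 -lt0n reach_proper.
Qed.

Lemma wt_touching x y :
  \sum_(e in touching x) wt e = \sum_(e in touching y) wt e.
Proof.
have E z : \sum_(e in touching z) wt e = \sum_(e in darts) wt e - 2 * alpha.
  rewrite -(balanced z) [X in _ = X - _](bigID (fun e => z \in reach e)) /= addrK.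
  by apply: eq_bigl => e; rewrite inE.
by rewrite !E.
Qed.

(** A further dart touching [y] would add a positive weight, against [wt_touching]. *)
Lemma touching_sub x y : touching x \subset touching y -> touching x = touching y.
Proof.
move=> sub; apply/eqP; rewrite eqEsubset sub /=; apply/subsetP=> e ey.
apply: contraT => ex; have := wt_touching x y.
have hd u e' : e' \in touching u -> e' \in darts by rewrite inE => /andP[].
move/eqP; rewrite [X in _ == X](big_setID (touching x)) /=.
rewrite (setIidPr sub) -subr_eq0 opprD addrA subrr add0r oppr_eq0.
rewrite (bigD1 e) /=; last by rewrite !inE in ex ey *; rewrite ex.
rewrite gt_eqF // ltr_pwDl ?wt_gt0 ?(hd _ _ ey) // sumr_ge0 // => e'.
by move=> /andP[/setDP[/hd /wt_gt0 /ltW]].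
Qed.

(** All darts at [y] touch [y] too, so [x] and [y] are touched by the same darts. An edge [zu]
    touches [y], hence [x], and so ends at [y]. *)
Lemma nbr_leaf x y z : nbr x = [set y] -> z \in nbr y -> nbr z = [set y].
Proof.
move=> hx hz.
have hxy : h x y by have := set11 y; rewrite -hx inE.
have sub : touching x \subset touching y.
  rewrite !touchingE // hx big_set1; apply/subsetP=> e he.
  move: (he); rewrite inE => /andP[]; rewrite inE => hde /orP[]/eqP E.
    by apply/bigcupP; exists e.2; rewrite ?inE ?hde -?E ?eqxx ?orbT.
  by apply/bigcupP; exists e.1; rewrite ?inE ?hde -?E ?eqxx ?orbT // h_sym.
have {}sub := touching_sub sub.
apply/setP=> u; rewrite in_set1; apply/idP/eqP => [|->]; last first.
  by move: hz; rewrite !inE h_sym.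
rewrite inE => zu.
have : (z, u) \in touching y.
  by rewrite touchingE //; apply/bigcupP; exists z; rewrite // !inE zu eqxx.
rewrite -sub touchingE // hx big_set1 !inE zu /= => /orP[] /eqP // E.
by move: hz; rewrite E inE h_irr.
Qed.

(** No dart touches an isolated vertex, so by equality of weights none touches any vertex; yet a
    dart touches its own ends. *)
Lemma nbr0 x : nbr x = set0 -> darts = set0.
Proof.
move=> hx; have tx : touching x = set0 by rewrite touchingE // hx big_set0.
apply/setP=> e; rewrite [RHS]inE; apply/negP=> he.
have /touching_sub : touching x \subset touching e.1 by rewrite tx sub0set.
rewrite tx => /setP/(_ e); rewrite in_set0 inE he /= !inE; move: he.
by rewrite inE h_sym => ->; rewrite orbT.
Qed.

(* An isolated vertex is a centre, and so are both ends of a [K_2] component. *)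
Definition star_center y := [forall z in nbr y, nbr z == [set y]].
Definition star_set := [set x | [exists y, (x \in y |: nbr y) && star_center y]].

Lemma star_centerP y : reflect {in nbr y, forall z, nbr z = [set y]} (star_center y).
Proof. by apply: (iffP forall_inP) => H z /H /eqP. Qed.

Lemma star_set_closed x u : h x u -> (x \in star_set) = (u \in star_set).
Proof.
have half a b : h a b -> a \in star_set -> b \in star_set.
  move=> hab; rewrite !inE => /existsP[y /andP[ay cy]].
  apply/existsP; exists y; rewrite cy andbT.
  move: ay; rewrite in_setU1 => /orP[/eqP E|ay].
    by rewrite !inE -E hab orbT.
  have : b \in nbr a by rewrite inE.
  by rewrite (star_centerP _ cy) // => /set1P ->; rewrite setU11.
by move=> hxu; apply/idP/idP; apply: half; rewrite // h_sym.
Qed.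

Lemma leaf_center x y : nbr x = [set y] -> star_center y.
Proof. by move=> hx; apply/star_centerP=> z; apply: nbr_leaf hx. Qed.

Lemma leaf_star x y : nbr x = [set y] -> x \in star_set.
Proof.
move=> hx; rewrite inE; apply/existsP; exists y; rewrite (leaf_center hx) andbT.
by rewrite in_setU1 nbr_sym // hx set11 orbT.
Qed.

Lemma reach_star_center y e : star_center y -> e \in darts -> e.1 \in y |: nbr y ->
  reach e = y |: nbr y.
Proof.
move=> /star_centerP cy; rewrite inE => he; rewrite in_setU1 => /orP[/eqP E|ey].
  by rewrite -[reach e]/(nbr e.1 :|: nbr e.2) E (cy e.2) 1?setUC // inE -E.
rewrite -[reach e]/(nbr e.1 :|: nbr e.2) (cy _ ey); suff -> : e.2 = y by [].
by apply/set1P; rewrite -(cy _ ey) inE.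
Qed.

(** The darts touching a leaf are those of its star, and each reaches exactly the whole star. *)
Lemma wt_touching_leaf x y : nbr x = [set y] ->
  \sum_(e in touching x) wt e = (2 * #|nbr y|)%:R / (#|T| - #|nbr y|.+1)%:R.
Proof.
move=> hx; have cy := leaf_center hx.
rewrite touchingE // hx big_set1 -card_darts_at // -sum1_card natr_sum mulr_suml.
apply: eq_bigr => e; rewrite inE => /andP[he ey]; rewrite mul1r /wt.
rewrite (reach_star_center cy he); last first.
  rewrite in_setU1; case/orP: ey => /eqP E; first by rewrite E eqxx.
  by move: he; rewrite inE E h_sym [_ \in nbr y]inE => ->; rewrite orbT.
by rewrite cardsCs setCK cardsU1 nbrxx.
Qed.

Lemma leaf_ltn x y : nbr x = [set y] -> (#|nbr y|.+1 < #|T|)%N.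
Proof.
move=> hx; have hxy : (x, y) \in darts.
  by have := set11 y; rewrite -hx !inE.
have := reach_proper hxy; rewrite (reach_star_center (leaf_center hx) hxy); last first.
  by rewrite in_setU1 nbr_sym // hx set11 orbT.
by rewrite cardsCs setCK cardsU1 nbrxx // subn_gt0.
Qed.

(** The quotient [d / (n - d - 1)] is strictly increasing for [d < n - 1], so the common weight
    determines the degree. *)
Lemma leaf_degree x y x' y' : nbr x = [set y] -> nbr x' = [set y'] ->
  #|nbr y| = #|nbr y'|.
Proof.
move=> hx hx'; have lt := leaf_ltn hx; have lt' := leaf_ltn hx'.
have := wt_touching x x'; rewrite (wt_touching_leaf hx) (wt_touching_leaf hx').
move/eqP; rewrite eqr_div ?pnatr_eq0 -?lt0n ?subn_gt0 // -!natrM eqr_nat.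
by move=> /eqP; nia.
Qed.

(** * Counting inside and outside the stars *)

Hypothesis no_isolated : forall x, nbr x != set0.
Variables x0 y0 : T.
Hypothesis x0_leaf : nbr x0 = [set y0].
Let l := #|nbr y0|.

Lemma star_center_degree y : star_center y -> #|nbr y| = l.
Proof.
move=> /star_centerP cy; have /set0Pn[z zy] := no_isolated y.
exact: leaf_degree (cy _ zy) x0_leaf.
Qed.

Lemma reach_star e : e \in darts -> e.1 \in star_set ->
  (reach e \subset star_set) && (#|reach e| == l.+1).
Proof.
move=> he; rewrite inE => /existsP[y /andP[ey cy]].
rewrite (reach_star_center cy he ey) cardsU1 nbrxx // star_center_degree // eqxx andbT.
by apply/subsetP=> z zy; rewrite inE; apply/existsP; exists y; rewrite zy.
Qed.

Lemma reach_nonstar e : e \in darts -> e.1 \notin star_set -> [disjoint star_set & reach e].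
Proof.
move=> he e1; rewrite disjoint_sym disjoint_subset; apply/subsetP=> x.
have e2 : e.2 \notin star_set.
  by rewrite -(@star_set_closed e.1) //; rewrite inE in he.
by rewrite mem_reach [_ \in predC _]inE => /orP[] /star_set_closed <-.
Qed.

Lemma nonstar_degree x : x \notin star_set -> (1 < #|nbr x|)%N.
Proof.
apply: contraR; rewrite -leqNgt => d; have : #|nbr x| == 1%N.
  by rewrite eqn_leq d card_gt0 no_isolated.
by move=> /cards1P[y /(@leaf_star x)].
Qed.

(** Double counting of the touching weight over [star_set]: each vertex receives [2l / (n - l - 1)],
    each dart in a star gives [1 / (n - l - 1)] to [l + 1] vertices, and no other dart reaches a
    star. *)
Lemma card_darts_star :
  (l.+1 * #|darts_from h star_set| = 2 * l * #|star_set|)%N.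
Proof.
have lt := leaf_ltn x0_leaf; rewrite -/l in lt.
have n0 : (#|T| - l.+1)%:R != 0 :> rat by rewrite pnatr_eq0 -lt0n subn_gt0.
have : \sum_(x in star_set) \sum_(e in touching x) wt e =
    \sum_(x in star_set) (2 * l)%:R / (#|T| - l.+1)%:R.
  by apply: eq_bigr => x _; rewrite (wt_touching x x0) (wt_touching_leaf x0_leaf).
rewrite sumr_const (exchange_big_dep (mem darts)) /=; last first.
  by move=> x e _; rewrite inE => /andP[].
rewrite (bigID (fun e => e.1 \in star_set)) /= [X in _ + X]big1 ?addr0 => [|e /andP[he e1]].
  rewrite (eq_bigr (fun=> l.+1%:R / (#|T| - l.+1)%:R)) => [|e /andP[he e1]].
    rewrite (eq_bigl (mem (darts_from h star_set))) => [|e]; last by rewrite !inE.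
    rewrite sumr_const -!mulrnAl => /(divIf n0) /eqP.
    by rewrite -!mulrnA eqr_nat => /eqP.
  have /andP[sub /eqP c] := reach_star he e1.
  rewrite (eq_bigl (mem (reach e))) => [|x /=]; last first.
    rewrite [e \in touching x]inE he /=; apply/andP/idP => [[] //|xe]; split=> //.
    exact: (subsetP sub).
  by rewrite sumr_const /wt cardsCs setCK c -[LHS]mulr_natl.
rewrite big1 // => x /andP[xs]; rewrite inE => /andP[_ xe].
by have /disjointFr := reach_nonstar he e1; move/(_ _ xs); rewrite xe.
Qed.

Lemma touching_from x : x \notin star_set -> touching x \subset darts_from h (~: star_set).
Proof.
move=> xs; apply/subsetP=> e; rewrite inE => /andP[he xe].
rewrite inE he in_setC /=; apply: contraTN xe => e1.
have /andP[/subsetP sub _] := reach_star he e1.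
by apply: contra xs => /sub.
Qed.

Lemma reach_le_touching e : e \in darts_from h (~: star_set) ->
  (2 * #|reach e| <= #|touching e.1|)%N.
Proof.
rewrite inE in_setC => /andP[]; rewrite inE; case: e => v w /= hvw vs.
apply: reach_touching => //; first exact: nonstar_degree.
by move=> u vu; apply: nonstar_degree; rewrite -(star_set_closed vu).
Qed.

(** Otherwise a dart outside the stars reaches at most [l] vertices and weighs at most
    [1 / (n - l)]; at most [2l] of these touch [x], and their sum falls short of
    [2l / (n - l - 1)]. *)
Lemma exists_touching x : x \notin star_set ->
  exists2 z, z \notin star_set & (2 * l.+1 <= #|touching z|)%N.
Proof.
move=> xs; have lt := leaf_ltn x0_leaf; rewrite -/l in lt.
have l0 : (0 < l)%N by rewrite card_gt0.
case: (pickP [pred z | (z \notin star_set) && (2 * l < #|touching z|)%N]).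
  move=> z /andP[zs tz]; exists z => //.
  by have [m mE] := even_touching h_sym h_irr z; rewrite mE in tz *; lia.
move=> small.
have {}small z : z \notin star_set -> (#|touching z| <= 2 * l)%N.
  by move=> zs; rewrite leqNgt; have := small z; rewrite /= zs => /= ->.
have reachE e : e \in touching x -> wt e <= (#|T| - l)%:R^-1.
  move=> /(subsetP (touching_from xs)) he.
  have := reach_le_touching he; move: he; rewrite inE in_setC => /andP[_ /small].
  move=> a b; rewrite lef_pV2 ?posrE ?ltr0n ?ler_nat ?subn_gt0.
  + by rewrite cardsCs setCK; lia.
  + by rewrite cardsCs setCK; lia.
  + by lia.
have : \sum_(e in touching x) wt e <= (2 * l)%:R / (#|T| - l)%:R.
  apply: le_trans (ler_sum _ reachE) _.
  by rewrite sumr_const -[leLHS]mulr_natl ler_wpM2r ?invr_ge0 ?ler0n // ler_nat small.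
rewrite (wt_touching x x0) (wt_touching_leaf x0_leaf) -/l.
rewrite ler_pM2l ?ltr0n ?muln_gt0 // lef_pV2 ?posrE ?ltr0n ?ler_nat ?subn_gt0 //; lia.
Qed.

(** Besides its two ends, an edge [vw] reaches a second neighbour of [v]. *)
Lemma card_reach_nonstar e : e \in darts_from h (~: star_set) -> (2 < #|reach e|)%N.
Proof.
rewrite inE in_setC => /andP[]; rewrite inE; case: e => v w /= hvw vs.
have := nonstar_degree vs; rewrite (cardsD1 w) inE hvw => d.
have sub : v |: nbr v \subset reach (v, w).
  by rewrite subUset sub1set mem_reach /= [h w v]h_sym hvw orbT subsetUl.
have := subset_leq_card sub; rewrite cardsU1 nbrxx // (cardsD1 w (nbr v)) inE hvw; lia.
Qed.

(** Cross-multiply [(l + 1) / (n - 3) <= l / (n - l - 1)]; the term [l] stands on the left to avoid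
    truncated subtraction. *)
Lemma card_bound x : x \notin star_set -> (#|T| + l <= l * l + 1)%N.
Proof.
move=> /exists_touching[z zs tz]; have lt := leaf_ltn x0_leaf; rewrite -/l in lt.
have l0 : (0 < l)%N by rewrite card_gt0.
have [e ez] : exists e, e \in touching z by apply/card_gt0P; lia.
have n3 : (3 < #|T|)%N.
  have ed := subsetP (touching_from zs) _ ez.
  have := card_reach_nonstar ed; move: ed; rewrite inE => /andP[/reach_proper].
  by rewrite cardsCs setCK; lia.
have : (2 * l.+1)%:R / (#|T| - 3)%:R <= \sum_(e in touching z) wt e.
  have : \sum_(e in touching z) (#|T| - 3)%:R^-1 <= \sum_(e in touching z) wt e :> rat.
    apply: ler_sum => e' /(subsetP (touching_from zs)) he.
    have := card_reach_nonstar he; move: he; rewrite inE => /andP[/reach_proper he _] c.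
    rewrite lef_pV2 ?posrE ?ltr0n ?ler_nat ?subn_gt0 //.
    by move: he; rewrite cardsCs setCK; lia.
  apply: le_trans; rewrite sumr_const -[leRHS]mulr_natl.
  by rewrite ler_wpM2r ?invr_ge0 ?ler0n // ler_nat.
rewrite (wt_touching z x0) (wt_touching_leaf x0_leaf) -/l.
rewrite ler_pdivrMr ?ltr0n ?subn_gt0 // mulrAC ler_pdivlMr ?ltr0n ?subn_gt0 //.
by rewrite -!natrM ler_nat; nia.
Qed.

Lemma card_darts_split :
  (#|darts| = #|darts_from h star_set| + #|darts_from h (~: star_set)|)%N.
Proof.
rewrite -(cardsID (darts_from h star_set) darts); congr (_ + _)%N.
  by apply: eq_card => e; rewrite !inE andbA andbb.
by apply: eq_card => e; rewrite !inE; case: (h _ _); rewrite /= ?andbF ?andbT.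
Qed.

Lemma star_set_full : alpha <= 9%:R / 10%:R -> forall x, x \in star_set.
Proof.
move=> small x; apply: contraT => xs.
have [z zs tz] := exists_touching xs.
have cT : #|T| = (#|star_set| + #|~: star_set|)%N by rewrite cardsC.
apply: False_ind; apply: (@star_count_contradiction l #|star_set| #|~: star_set|
    #|darts_from h star_set| #|darts_from h (~: star_set)|).
- by rewrite card_gt0.
- by apply/card_gt0P; exists x; rewrite inE.
- have hxy : (x0, y0) \in darts by have := set11 y0; rewrite -x0_leaf !inE.
  have /andP[sub /eqP <-] := reach_star hxy (leaf_star x0_leaf).
  exact: subset_leq_card.
- exact: card_darts_star.
- rewrite -cT -card_darts_split -(ler_nat rat) !natrM -card_darts.
  have : (0 : rat) <= #|T|%:R by [].
  nra.
- by rewrite -cT; apply: card_bound xs.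
- exact: leq_trans tz (subset_leq_card (touching_from zs)).
- rewrite card_darts_from // mulnC -sum_nat_const; apply: leq_sum => u.
  by rewrite inE => /nonstar_degree.
(* Equality makes all degrees outside the stars equal to 2, so at most [2 * 4] darts touch [z];
   since at least [2 * l.+1] do, [l <= 3]. *)
rewrite card_darts_from // mulnC -sum_nat_const => /eqP; rewrite eq_sym.
have le2 u : u \in ~: star_set -> (2 <= #|nbr u| ?= iff (#|nbr u| == 2))%N.
  by rewrite inE => /nonstar_degree d; split=> //; rewrite eq_sym.
rewrite (leqif_sum le2) => /forall_inP deg2.
have {}deg2 u : u \notin star_set -> #|nbr u| = 2.
  by move=> us; apply/eqP/deg2; rewrite inE.
have : (#|touching z| <= \sum_(u in nbr z) #|darts_at h u|)%N.
  rewrite touchingE //; elim/big_rec2: _ => [|u m B _ IH]; first by rewrite cards0.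
  by rewrite (leq_trans (leq_card_setU _ _)) // leq_add2l.
rewrite (eq_bigr (fun=> 4)) => [|u zu].
  by rewrite sum_nat_const deg2 //; lia.
rewrite card_darts_at // deg2 // -(@star_set_closed z) //.
by rewrite inE in zu.
Qed.

End Balanced.

(** The combinatorial core, with [h] in the role of the complement; [y] is a centre of the component
    of [x]. *)
Theorem balanced_stars (T : finType) (h : rel T) (alpha : rat) :
    symmetric h -> irreflexive h -> (0 < #|T|)%N ->
    (forall e, e \in darts h -> (0 < #|~: reach h e|)%N) ->
    (forall x, \sum_(e in darts h | x \notin reach h e) wt h e = 2 * alpha) ->
    alpha <= 9%:R / 10%:R ->
  exists l : nat, alpha = l%:R / (l%:R + 1) /\
    forall x, exists y, [/\ x \in y |: nbr h y, #|nbr h y| = l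
      & {in nbr h y, forall z, nbr h z = [set y]}].
Proof.
move=> h_sym h_irr T0 reach_proper balanced small.
have T0' : #|T|%:R != 0 :> rat by rewrite pnatr_eq0 -lt0n.
have cd := card_darts reach_proper balanced.
(* An isolated vertex excludes all edges: this is the case [l = 0]. *)
case: (pickP [pred x | nbr h x == set0]) => [x /= /eqP hx|].
  have d0 := nbr0 h_sym reach_proper balanced hx.
  have n0 y : nbr h y = set0.
    apply/setP=> z; rewrite [RHS]inE; apply/negP=> yz.
    by have := in_set0 (y, z); rewrite -d0 inE /=; move: yz; rewrite inE => ->.
  exists 0; split=> [|y]; last first.
    by exists y; rewrite n0 cards0 setU11; split=> // z; rewrite inE.
  move: cd; rewrite d0 cards0 mul0r => /eqP.
  by rewrite !mulf_eq0 (negPf T0') orbF pnatr_eq0 /= => /eqP.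
move=> nz; have {}nz x : nbr h x != set0 by have /= -> := nz x.
(* The degree sum is [2 * alpha * n < 2 * n], so not all degrees are at least 2. *)
have [x0 dx0] : exists x, (#|nbr h x| <= 1)%N.
  case: (pickP [pred x | (#|nbr h x| <= 1)%N]) => [x ?|big]; first by exists x.
  have : (2 * #|T| <= #|darts h|)%N.
    have -> : darts h = darts_from h setT by apply/setP=> e; rewrite !inE andbT.
    rewrite card_darts_from mulnC -cardsT -sum_nat_const; apply: leq_sum => x _.
    by rewrite ltnNge; have /= -> := big x.
  rewrite -(ler_nat rat) natrM -cd.
  have : (0 : rat) < #|T|%:R by rewrite ltr0n.
  nra.
have /cards1P[y0 hx0] : #|nbr h x0| == 1%N by rewrite eqn_leq dx0 card_gt0 nz.
have full := star_set_full h_sym h_irr reach_proper balanced nz hx0 small.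
have cds := card_darts_star h_sym h_irr reach_proper balanced nz hx0.
exists #|nbr h y0|; split=> [|x].
  have sT : star_set h = setT by apply/setP=> x; rewrite full inE.
  have dT : darts_from h setT = darts h by apply/setP=> e; rewrite !inE andbT.
  move: cds; rewrite sT dT cardsT => /(congr1 (fun n => n%:R : rat)).
  rewrite !natrM -cd -natr1 => E.
  have n0 : #|nbr h y0|%:R + 1 != 0 :> rat by rewrite natr1 pnatr_eq0.
  by apply/(mulIf n0)/(mulIf T0'); rewrite divfK //; lra.
have := full x; rewrite inE => /existsP[y /andP[xy cy]].
exists y; split=> //; last exact/star_centerP.
exact: (star_center_degree h_sym h_irr reach_proper balanced nz hx0 cy).
Qed.

(** * Components as stars, and sums over pairs *)

Lemma star_component (H : graph) (l : nat) (x y : H) :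
    x \in y |: nbr edge y -> #|nbr edge y| = l ->
    {in nbr edge y, forall z, nbr edge z = [set y]} ->
  isomorphic (induced [set z | connect edge x z]) (star l).
Proof.
move=> xy degy leaf.
have Hsym : connect_sym (@edge H) by apply: sym_connect_sym; exact: edge_sym.
have clS : closed edge (y |: nbr edge y).
  apply: intro_closed => // a b ab; rewrite !in_setU1 => /orP[/eqP E|ay].
    by rewrite inE -E ab orbT.
  have : b \in nbr edge a by rewrite inE.
  by rewrite leaf // inE => ->.
set C := [set z | _].
have CE : C = y |: nbr edge y.
  apply/setP=> z; rewrite inE; apply/idP/idP => [xz|zy].
    by rewrite -(closed_connect clS xz).
  have cy u : u \in y |: nbr edge y -> connect edge y u.
    by rewrite in_setU1 inE => /orP[/eqP-> //|/connect1].
  by apply: connect_trans (cy _ zy); rewrite Hsym cy.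
(* With [y] first, [index] sends it to [ord0], the centre of [star l]. *)
pose s := y :: enum (nbr edge y).
have szs : size s = l.+1 by rewrite /= -cardE degy.
have valS (a : induced C) : val a \in y |: nbr edge y by rewrite -CE; exact: valP.
have ms (a : induced C) : val a \in s.
  by have := valS a; rewrite in_setU1 in_cons mem_enum.
have is_lt (a : induced C) : (index (val a) s < l.+1)%N by rewrite -szs index_mem ms.
pose f (a : induced C) : star l := Ordinal (is_lt a).
have f0 a : (f a == ord0) = (val a == y).
  by rewrite -val_eqE /= [y == _]eq_sym; case: (val a == y).
have f_inj : injective f.
  move=> a b /(congr1 val) /= E; apply: val_inj.
  by rewrite -(nth_index y (ms a)) -(nth_index y (ms b)) /s /= E.
exists f.
  apply: inj_card_bij => //; rewrite card_ord card_sig.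
  have -> : #|[pred x0 | x0 \in C]| = #|C| by apply: eq_card.
  by rewrite CE cardsU1 inE edge_irr degy.
move=> a b; rewrite /edge /= /star_edge /induced_edge !f0.
have nb (c : induced C) : val c != y -> val c \in nbr edge y.
  by have := valS c; rewrite in_setU1 => /orP[->|].
case: (eqVneq (val a) y) => ay; case: (eqVneq (val b) y) => yb /=.
- by rewrite ay yb edge_irr.
- by rewrite ay; have := nb b yb; rewrite inE.
- by rewrite yb edge_sym; have := nb a ay; rewrite inE.
- by have /setP/(_ (val b)) := leaf _ (nb a ay); rewrite !inE (negPf yb).
Qed.

(** Relates [betweenness], with one orientation per pair, to sums over darts, with both. *)
Lemma half_sum (R : nzRingType) (T : finType) (g : T -> T -> R) :
    (forall v w, g v w = g w v) -> (forall v, g v v = 0) ->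
  2 * (\sum_v \sum_(w | (enum_rank v < enum_rank w)%N) g v w)
    = \sum_v \sum_w g v w.
Proof.
move=> g_sym g0; rewrite mulr_natl mulr2n.
rewrite {2}(exchange_big_dep predT) //= -big_split /=; apply: eq_bigr => v _.
rewrite (bigID (fun w : T => (enum_rank v < enum_rank w)%N) predT) /=; congr (_ + _).
rewrite [RHS](bigD1 v) ?ltnn //= g0 add0r; apply: eq_big => [w|w _]; last exact: g_sym.
by rewrite -leqNgt ltn_neqAle andbC (inj_eq val_inj) (inj_eq enum_rank_inj).
Qed.

(** * Distances and shortest paths *)

Section Distance.
Variable G : graph.
Implicit Types v w x z : G.

Lemma dist_le v w k : (k < #|G|)%N -> paths v w k != set0 -> (dist v w <= k)%N.
Proof.
move=> kG pk; rewrite leqNgt; apply/negP => /(before_find 0).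
by rewrite nth_iota // pk.
Qed.

(** A duplicate-free path has fewer than [#|G|] edges, so the search in [dist] succeeds and its
    default value does not occur. *)
Lemma dist_paths v w : connected G -> paths v w (dist v w) != set0.
Proof.
move=> /(_ v w) /connectP[p0 /shortenP[p pp up _] ->].
have szp : (size p < #|G|)%N.
  by have := max_card (mem (v :: p)); rewrite (card_uniqP up).
have hs : has (fun k => paths v (last v p) k != set0) (iota 0 #|G|).
  apply/hasP; exists (size p); first by rewrite mem_iota.
  by apply/set0Pn; exists (in_tuple p); rewrite inE pp eqxx up.
have := nth_find 0 hs; rewrite nth_iota //.
by rewrite has_find size_iota in hs.
Qed.

(** Each shortest path has [(dist v w).-1] internal vertices. *)
Lemma sum_sigma_through v w : v != w ->
  (\sum_x sigma_through v w x = sigma v w * (dist v w).-1)%N.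
Proof.
move=> vw; rewrite /sigma_through /sigma.
transitivity (\sum_x \sum_(p in shortest_paths v w | [&& x \in v :: p, x != v & x != w]) 1)%N.
  by apply: eq_bigr => x _; rewrite -sum1_card; apply: eq_bigl => p; rewrite inE.
rewrite (exchange_big_dep (mem (shortest_paths v w))) /=; last by move=> x p _ /andP[].
rewrite -sum_nat_const; apply: eq_bigr => p hp; rewrite sum1_card.
have /and3P[_ /eqP lp up] : [&& path edge v p, last v p == w & uniq (v :: p)].
  by move: hp; rewrite inE.
rewrite (eq_card (B := [set x in v :: p] :\ v :\ w)) => [|x]; last first.
  rewrite unfold_in /= hp /= 2!in_setD1 [x \in finset _]inE.
  by case: (x == v); case: (x == w); rewrite /= ?andbF ?andbT.
have : #|[set x in v :: p]| = (dist v w).+1.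
  by rewrite cardsE (card_uniqP up) /= size_tuple.
rewrite (cardsD1 v) (cardsD1 w (_ :\ v)) !inE eqxx /= [w == v]eq_sym vw /=.
have -> : w \in (p : seq G).
  by move: (mem_last v p); rewrite lp in_cons [w == v]eq_sym (negPf vw).
rewrite orbT; lia.
Qed.

Hypothesis G_conn : connected G.

Lemma sigma_gt0 v w : (0 < sigma v w)%N.
Proof. by rewrite card_gt0; exact: dist_paths. Qed.

Lemma sum_betweenness : \sum_(x : G) betweenness x =
  \sum_(v : G) \sum_(w : G | (enum_rank v < enum_rank w)%N) (dist v w).-1%:R.
Proof.
rewrite exchange_big; apply: eq_bigr => v _; rewrite exchange_big; apply: eq_bigr => w vw.
have nvw : v != w by apply: contraTneq vw => ->; rewrite ltnn.
rewrite -mulr_suml -natr_sum sum_sigma_through // natrM mulrAC mulfV ?mul1r //.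
by rewrite pnatr_eq0 -lt0n sigma_gt0.
Qed.

Lemma dist_gt1 v w : compl_edge v w -> (1 < dist v w)%N.
Proof.
move=> /andP[vw nvw]; have := dist_paths v w G_conn.
case: (dist v w) => [|[|//]] /set0Pn[p]; rewrite inE.
  by rewrite (tuple0 p) /= (negPf vw).
case/tupleP: p => a p; rewrite (tuple0 p) /= andbT => /and3P[va /eqP aw _].
by rewrite aw (negPf nvw) in va.
Qed.

Lemma dist_gt2 v w : compl_edge v w -> (forall z, ~~ (edge v z && edge z w)) ->
  (2 < dist v w)%N.
Proof.
move=> vw nz; have := dist_gt1 vw; have := dist_paths v w G_conn.
case: (dist v w) => [|[|[|//]]] // /set0Pn[p]; rewrite inE.
case/tupleP: p => a p; case/tupleP: p => b p; rewrite (tuple0 p) /= andbT.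
by move=> /and3P[/andP[va ab] /eqP bw _]; have := nz a; rewrite va -bw ab.
Qed.

Lemma mem_compl_reach x v w : compl_edge v w ->
  (x \notin reach (@compl_edge G) (v, w)) = edge v x && edge x w.
Proof.
move=> /andP[vw nvw]; rewrite mem_reach /= /compl_edge negb_or !negb_and !negbK.
rewrite [edge x w]edge_sym; case: (eqVneq v x) => [<-|]; last first.
  by case: (eqVneq w x) => [<-|//]; rewrite (negPf nvw).
by rewrite eq_sym (negPf vw) edge_irr edge_sym (negPf nvw).
Qed.

(** Otherwise [d(u,v) >= 3], and the sum of [d - 1] over all pairs is at least [n], against
    [alpha < 1]. *)
Lemma common_neighbor (alpha : rat) (G_alpha : forall x : G, betweenness x = alpha) :
  alpha < 1 -> forall u v, compl_edge u v -> exists z, edge u z && edge z v.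
Proof.
move=> small u v huv; case: (pickP [pred z | edge u z && edge z v]) => [z ?|none].
  by exists z.
have {}none z : ~~ (edge u z && edge z v) by have /= -> := none z.
have none' z : ~~ (edge v z && edge z u).
  by rewrite andbC edge_sym [edge v z]edge_sym.
have hvu : compl_edge v u by rewrite compl_edge_sym.
have uv : u != v by case/andP: huv.
pose h := @compl_edge G.
pose far a b := ((a, b) == (u, v)) || ((a, b) == (v, u)).
(* A lower bound for [d(a,b) - 1]: 1 for a nonadjacent pair, and 1 more for the pair [u], [v]. *)
pose g a b := ((h a b)%:R + (far a b)%:R : rat).
have g_sym a b : g a b = g b a.
  by rewrite /g /h compl_edge_sym /far !xpair_eqE orbC andbC [(b == v) && _]andbC.
have g0 a : g a a = 0.
  rewrite /g /h compl_edge_irr /far !xpair_eqE.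
  by case: (eqVneq a u) => [->|]; rewrite ?(negPf uv) /= ?andbF ?addr0.
have g_le a b : g a b <= (dist a b).-1%:R.
  rewrite /g -natrD ler_nat /far /h.
  case: (boolP (_ || _)) => [/orP[] /eqP[-> ->]|_].
  - by rewrite huv; have := dist_gt2 huv none; lia.
  - by rewrite hvu; have := dist_gt2 hvu none'; lia.
  - by case: (boolP (compl_edge a b)) => // /dist_gt1; lia.
have : 2 * (\sum_a \sum_(b | (enum_rank a < enum_rank b)%N) g a b)
    <= 2 * (alpha * #|G|%:R).
  have -> : alpha * #|G|%:R = \sum_(x : G) betweenness x.
    by rewrite (eq_bigr _ (fun x _ => G_alpha x)) sumr_const mulr_natr.
  rewrite sum_betweenness ler_pM2l //; apply: ler_sum => a _.
  by apply: ler_sum => b _; exact: g_le.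
rewrite (half_sum g_sym g0) pair_big /= /g big_split /=.
have -> : \sum_(p : G * G) (h p.1 p.2)%:R = #|darts h|%:R :> rat.
  rewrite -sum1_card natr_sum [RHS]big_mkcond /=; apply: eq_bigr => p _.
  by rewrite inE; case: (h _ _).
have -> : \sum_(p : G * G) (far p.1 p.2)%:R = 2 :> rat.
  have -> : 2 = #|[set (u, v); (v, u)]|%:R :> rat.
    by rewrite cards2 xpair_eqE (negPf uv).
  rewrite -sum1_card natr_sum [RHS]big_mkcond /=; apply: eq_bigr => -[a b] _.
  by rewrite in_set2 /far /=; case: (_ || _).
have cov : nbr h u :|: nbr h v = setT.
  apply/setP=> x; rewrite [RHS]inE -[LHS]/(x \in reach h (u, v)).
  by rewrite -[LHS]negbK mem_compl_reach // none.
(* The complement degrees of [u] and [v] sum to at least [n], and each of the other [n - 2] vertices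
   has degree at least 1. *)
have : (2 * #|G| <= #|darts h| + 2)%N.
  have -> : darts h = darts_from h setT by apply/setP=> e; rewrite !inE andbT.
  rewrite card_darts_from; under eq_bigl do rewrite inE.
  rewrite (bigD1 u) //= (bigD1 v) 1?eq_sym //=.
  have : (#|G| <= #|nbr h u| + #|nbr h v|)%N.
    by rewrite -cardsT -cov leq_card_setU.
  have : (\sum_(a | (a != u) && (a != v)) 1 <= \sum_(a | (a != u) && (a != v)) #|nbr h a|)%N.
    apply: leq_sum => a _; rewrite card_gt0; apply/set0Pn.
    have : a \in nbr h u :|: nbr h v by rewrite cov inE.
    rewrite !inE => /orP[] ha; [exists u | exists v];
      by rewrite inE /h compl_edge_sym.
  have : #|G| = (1 + (1 + \sum_(a | (a != u) && (a != v)) 1))%N.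
    by rewrite -sum1_card (bigD1 u) //= (bigD1 v) 1?eq_sym.
  move: (\sum_(a | _) 1)%N (\sum_(a | _) #|nbr h a|)%N #|G| #|nbr h u| #|nbr h v|.
  lia.
rewrite -(ler_nat rat) natrD natrM => H1 H2.
have : 0 < #|G|%:R :> rat by rewrite ltr0n; apply/card_gt0P; exists u.
nra.
Qed.

Lemma sigma_through_edge v w x : edge v w -> sigma_through v w x = 0.
Proof.
move=> evw; have vw : v != w by apply: contraTneq evw => ->; rewrite edge_irr.
have d1 : (dist v w <= 1)%N.
  apply: dist_le.
    by have := max_card (mem [:: v; w]); rewrite (card_uniqP _) //= inE vw.
  by apply/set0Pn; exists [tuple w]; rewrite inE /= evw eqxx inE vw.
have : (\sum_y sigma_through v w y)%N = 0 by rewrite sum_sigma_through //; lia.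
by move=> /eqP; rewrite sum_nat_eq0 => /forall_inP/(_ x isT) /eqP.
Qed.

(** The tuple type depends on [dist v w]; a separate [k] allows its replacement by 2. *)
Lemma sigma_throughE v w k x : dist v w = k ->
  sigma_through v w x =
    #|[set p : k.-tuple G in paths v w k | [&& x \in v :: p, x != v & x != w]]|.
Proof. by move=> <-. Qed.

Lemma sigmaE v w k : dist v w = k -> sigma v w = #|paths v w k|.
Proof. by move=> <-. Qed.

(** * Nonadjacent pairs with a common neighbour *)

Section DistanceTwo.
Variables v w : G.
Hypotheses (vw : compl_edge v w) (vzw : exists z, edge v z && edge z w).

Lemma mem_paths2 (p : 2.-tuple G) :
  (p \in paths v w 2) =
    (tnth p ord_max == w) && (tnth p ord0 \notin reach (@compl_edge G) (v, w)).
Proof.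
case/tupleP: p => a p; case/tupleP: p => b p; rewrite (tuple0 p).
rewrite mem_compl_reach // inE /= /tnth /= !inE.
case: (eqVneq b w) => [->|]; rewrite ?andbF //=.
case: (boolP (edge v a && edge a w)) => [/andP[va aw]|/negPf];
  rewrite ?andbT; last by case: (edge v a) => //= ->.
rewrite va aw /= negb_or; case/andP: (vw) => -> _; rewrite andbT /=.
by rewrite (contraTneq _ va) ?(contraTneq _ aw) // => ->; rewrite edge_irr.
Qed.

Lemma dist2 : dist v w = 2.
Proof.
apply/eqP; rewrite eqn_leq dist_gt1 // andbT.
have [z zE] := vzw; apply: dist_le; last first.
  by apply/set0Pn; exists [tuple z; w]; rewrite mem_paths2 mem_compl_reach // zE /tnth /= eqxx.
have /andP[vz zw] := zE.
(* Three distinct vertices put 2 within the search range of [dist]. *)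
have : uniq [:: v; z; w].
  rewrite /= !inE negb_or; case/andP: (vw) => -> _.
  by rewrite (contraTneq _ vz) ?(contraTneq _ zw) // => ->; rewrite edge_irr.
by move=> /card_uniqP /= <-; exact: max_card.
Qed.

(** A path with two edges is determined by its midpoint, a common neighbour of [v] and [w]. *)
Lemma sigma2 : sigma v w = #|~: reach (@compl_edge G) (v, w)|.
Proof.
rewrite (sigmaE dist2).
have -> : paths v w 2 = [set [tuple z; w] | z in ~: reach (@compl_edge G) (v, w)].
  apply/setP=> p; rewrite mem_paths2; apply/idP/imsetP.
    case/tupleP: p => a p; case/tupleP: p => b p; rewrite (tuple0 p) /tnth /=.
    by move=> /andP[/eqP-> ad]; exists a; [rewrite inE | apply: val_inj].
  by move=> [z]; rewrite inE => zd ->; rewrite /tnth /= eqxx.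
by rewrite card_imset // => a b [].
Qed.

Lemma sigma_through2 x :
  sigma_through v w x = (x \notin reach (@compl_edge G) (v, w)).
Proof.
rewrite (sigma_throughE x dist2).
have -> : [set p : 2.-tuple G in paths v w 2 | [&& x \in v :: p, x != v & x != w]] =
    [set p in [set [tuple x; w]] | x \notin reach (@compl_edge G) (v, w)].
  apply/setP=> p; rewrite [LHS]inE mem_paths2 !in_set in_set1.
  case/tupleP: p => a p; case/tupleP: p => b p; rewrite (tuple0 p) /tnth /=.
  rewrite -val_eqE /= !eqseq_cons eqxx andbT !inE.
  case: (eqVneq b w) => [->|]; rewrite ?andbF //= andbT.
  case: (eqVneq a x) => [->|_]; last first.
    by case: (x == v); case: (x == w); rewrite ?andbF.
  have := mem_compl_reach x vw; rewrite mem_reach orbT /=; case: (_ || _) => //=.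
  move=> /esym/andP[vx xw].
  by rewrite (contraTneq _ vx) ?(contraTneq _ xw) // => ->; rewrite edge_irr.
case: (boolP (x \in _)) => _ /=.
  by rewrite (_ : [set p in _ | false] = set0) ?cards0 //;
    apply/setP=> p; rewrite !inE andbF.
by rewrite (_ : [set p in _ | true] = [set [tuple x; w]]) ?cards1 //;
  apply/setP=> p; rewrite !inE andbT.
Qed.

End DistanceTwo.
End Distance.

(** * From betweenness to the complement *)

Theorem theorem3 (G : graph) (alpha : rat)
  (G_nonempty : (0 < #|G|)%N)
  (G_bug : betweenness_uniform G)
  (G_alpha : forall x : G, betweenness x = alpha)
  (alpha_le : alpha <= 9%:R / 10%:R) :
  exists l : nat,
    alpha = l%:R / (l%:R + 1) /\
    (forall C : {set compl G}, C \in components (compl G) ->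
       isomorphic (induced C) (star l)).
Proof.
have [G_conn _] := G_bug.
pose h := @compl_edge G.
have h_sym : symmetric h by exact: compl_edge_sym.
have h_irr : irreflexive h by exact: compl_edge_irr.
have alpha1 : alpha < 1 by lra.
have near v w : h v w -> exists z, edge v z && edge z w.
  exact: common_neighbor G_conn alpha G_alpha alpha1 v w.
have reach_proper e : e \in darts h -> (0 < #|~: reach h e|)%N.
  rewrite inE; case: e => v w /= vw; have [z zE] := near v w vw.
  by apply/card_gt0P; exists z; rewrite in_setC mem_compl_reach.
have balanced x : \sum_(e in darts h | x \notin reach h e) wt h e = 2 * alpha.
  (* The contribution of the pair [v], [w] to the betweenness of [x]; adjacent pairs contribute
     0. *)
  pose g v w := if h v w && (x \notin reach h (v, w)) then wt h (v, w) else 0.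
  have g_sym v w : g v w = g w v.
    by rewrite /g /wt h_sym /reach /= [nbr h v :|: _]setUC.
  have g0 v : g v v = 0 by rewrite /g h_irr.
  rewrite -(G_alpha x) /betweenness big_mkcond /=.
  transitivity (\sum_v \sum_w g v w).
    by rewrite pair_big /=; apply: eq_bigr => -[v w] _; rewrite /g inE.
  rewrite -(half_sum g_sym g0); congr (2 * _).
  apply: eq_bigr => v _; apply: eq_bigr => w vw.
  have nvw : v != w by apply: contraTneq vw => ->; rewrite ltnn.
  rewrite /g; case: (boolP (h v w)) => hvw /=.
    rewrite (sigma_through2 G_conn hvw (near v w hvw)).
    rewrite (sigma2 G_conn hvw (near v w hvw)) -/h.
    by case: (x \notin _); rewrite ?mul1r ?mul0r.
  rewrite sigma_through_edge ?mul0r //.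
  by move: hvw; rewrite /h /compl_edge nvw negbK.
have [l [alphaE stars]] := balanced_stars h_sym h_irr G_nonempty reach_proper balanced alpha_le.
exists l; split=> // C /imsetP[x _ ->].
have [y [xy dy leaf]] := stars x.
exact: (@star_component (compl G) l x y).
Qed.
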